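(* Under the standing assumptions on the data described in the context: (i) Let $(v^*,x^*,a^* )$ be an optimal solution to $(\mathsf{RP}_1)$, and let $(\mathbf{v}^*,x^*,w^* )$ be the feasible solution to $(\mathsf{CBP}_2)$ constructed from $(v^*,x^*,a^* )$ by the recovery construction described in the context. Then $(\mathbf{v}^*,x^*,w^* )$ is optimal to $(\mathsf{CBP}_2)$. (ii) Conversely, let $(\mathbf{v}^*,x^*,w^* )$ be an optimal solution to $(\mathsf{CBP}_2)$, and for each $j\in\mathcal{J}$ let $$v_j^*=\sum_{\mathcal{A}\subseteq\mathcal{J}}(w^* )^{\mathcal{A}}(v^* )_j^{\mathcal{A}},\qquad a_j^*=\frac{\sum_{\mathcal{A}\subseteq\mathcal{J}}\mathbf{1}(j\in\mathcal{A})(w^* )^{\mathcal{A}}(v^* )_j^{\mathcal{A}}}{\sum_{\mathcal{A}\subseteq\mathcal{J}}(w^* )^{\mathcal{A}}(v^* )_j^{\mathcal{A}}}$$ (with $a_j^*=0$ if the denominator is zero). Then $(v^*,x^*,a^* )$ is an optimal solution to $(\mathsf{RP}_1)$.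
   Context: Standing assumptions and data: $\mathcal{J}$ is a finite set of $J$ products. For each $j\in\mathcal{J}$ there are real numbers $\underline{x}_j\le\overline{x}_j$ (price bounds), $\psi_j$ (unit cost), $\alpha_j$, and $\beta_j>0$, such that $Q_j(x_j):=\exp(\alpha_j-\beta_jx_j)\in[0,1]$ for all $x_j\in[\underline{x}_j,\overline{x}_j]$. There are a vector $\theta=(\theta_j)_{j\in\mathcal{J}}\ge0$ with $\sum_{j\in\mathcal{J}}\theta_j=1$ and a matrix $\rho=(\rho_{ij})_{i,j\in\mathcal{J}}\ge0$ such that $I-\rho$ is nonsingular and $\sum_{n\ge1}\rho^n<\infty$ entrywise. $\mathcal{R}$ is a finite set of resources, with real $\varphi_r$ (capacity) and $\phi_{rj}$ (usage of $r$ per unit of $j$). $\overline{\lambda}\ge0$ is the total arrival volume (the integral of the arrival rate over the horizon). Problem $(\mathsf{CBP}_2)$: over real $w=(w^{\mathcal{A}})_{\mathcal{A}\subseteq\mathcal{J}}$, $\mathbf{v}=(v_j^{\mathcal{A}})_{j\in\mathcal{J},\mathcal{A}\subseteq\mathcal{J}}$, $x=(x_j)_{j\in\mathcal{J}}$, maximize $$\sum_{\mathcal{A}\subseteq\mathcal{J}}\overline{\lambda}\,w^{\mathcal{A}}\sum_{j\in\mathcal{A}}(x_j-\psi_j)\exp(\alpha_j-\beta_jx_j)\,v_j^{\mathcal{A}}$$ subject to: $\sum_{\mathcal{A}\subseteq\mathcal{J}}\overline{\lambda}w^{\mathcal{A}}\sum_{j\in\mathcal{A}}\phi_{rj}\exp(\alpha_j-\beta_jx_j)v_j^{\mathcal{A}}\le\varphi_r$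 for all $r\in\mathcal{R}$; $\sum_{\mathcal{A}\subseteq\mathcal{J}}w^{\mathcal{A}}=1$; $w\ge0$; $v_j^{\mathcal{A}}=\theta_j+\sum_{i\in\mathcal{J}}[1-\mathbf{1}(i\in\mathcal{A})\exp(\alpha_i-\beta_ix_i)]\rho_{ij}v_i^{\mathcal{A}}$ for all $j\in\mathcal{J}$, $\mathcal{A}\subseteq\mathcal{J}$; $\underline{x}_j\le x_j\le\overline{x}_j$ for all $j$. Problem $(\mathsf{RP}_1)$: over $v,x,a\in\mathbb{R}^{\mathcal{J}}$, maximize $\overline{\lambda}\sum_{j\in\mathcal{J}}(x_j-\psi_j)a_j\exp(\alpha_j-\beta_jx_j)v_j$ subject to: $v_j=\theta_j+\sum_{i\in\mathcal{J}}[1-a_i\exp(\alpha_i-\beta_ix_i)]\rho_{ij}v_i$ for all $j$; $\overline{\lambda}\sum_{j\in\mathcal{J}}\phi_{rj}a_j\exp(\alpha_j-\beta_jx_j)v_j\le\varphi_r$ for all $r\in\mathcal{R}$; $a_j\in[0,1]$ and $\underline{x}_j\le x_j\le\overline{x}_j$ for all $j$. For given $x$ within the price bounds and $\mathcal{A}\subseteq\mathcal{J}$, let $v^{\mathcal{A}}=(v^{\mathcal{A}}_j)_{j\in\mathcal{J}}$ denote the unique solution of $v_j^{\mathcal{A}}=\theta_j+\sum_{i\in\mathcal{J}}[1-\mathbf{1}(i\in\mathcal{A})\exp(\alpha_i-\beta_ix_i)]\rho_{ij}v_i^{\mathcal{A}}$, $j\in\mathcal{J}$. Dimension Reduction algorithm,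 with input $(v,x,a)$ feasible for $(\mathsf{RP}_1)$. Initialization: $k=1$, $\hat v^{(1)}=v$, $\hat a^{(1)}=a$. Step 1: set $\mathcal{A}_k=\{j\in\mathcal{J}:\hat a_j^{(k)}\hat v_j^{(k)}>0\}$; if $\mathcal{A}_k=\varnothing$, set $y^{\mathcal{A}_k}=1$ and stop. Step 2: compute $v^{\mathcal{A}_k}$. Step 3: set $y^{\mathcal{A}_k}=\min\{\hat a_j^{(k)}\hat v_j^{(k)}/v_j^{\mathcal{A}_k}:j\in\mathcal{A}_k\}$ (a quotient with zero denominator and positive numerator counts as $+\infty$); if $y^{\mathcal{A}_k}=1$, stop. Step 4: set $\hat v_j^{(k+1)}=(\hat v_j^{(k)}-y^{\mathcal{A}_k}v_j^{\mathcal{A}_k})/(1-y^{\mathcal{A}_k})$ for $j\in\mathcal{J}$; $\hat a_j^{(k+1)}=(\hat a_j^{(k)}\hat v_j^{(k)}-y^{\mathcal{A}_k}v_j^{\mathcal{A}_k})/((1-y^{\mathcal{A}_k})\hat v_j^{(k+1)})$ for $j\in\mathcal{A}_k$ (interpreted as $0$ if $\hat v_j^{(k+1)}=0$); $\hat a_j^{(k+1)}=0$ for $j\in\mathcal{J}\setminus\mathcal{A}_k$. Step 5: increase $k$ by $1$ and go to Step 1. Recovery construction: let $K$ be the number of iterations after which the algorithm stops on input $(v,x,a)$; set $w^{\mathcal{A}_k}=(1-y^{\mathcal{A}_1})\cdots(1-y^{\mathcal{A}_{k-1}})y^{\mathcal{A}_k}$ for $k=1,\dots,K$, $w^{\mathcal{A}}=0$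 for every $\mathcal{A}\subseteq\mathcal{J}$ not in $\{\mathcal{A}_1,\dots,\mathcal{A}_K\}$, and $\mathbf{v}=(v^{\mathcal{A}})_{\mathcal{A}\subseteq\mathcal{J}}$. The constructed solution is $(\mathbf{v},x,w)$. *)

(* Defs.v *)
From mathcomp Require Import all_boot all_order all_algebra.
From mathcomp Require Import all_classical all_reals all_analysis.

Set Implicit Arguments.
Unset Strict Implicit.
Unset Printing Implicit Defensive.
Import Order.TTheory GRing.Theory Num.Theory.
Local Open Scope classical_set_scope.
Local Open Scope ring_scope.

(* J = 'I_n is the set of products and 'I_m the set of resources. *)
Record market (R : realType) (n m : nat) := Market {
  xlo : 'rV[R]_n;         (* lower price bounds *)
  xhi : 'rV[R]_n;         (* upper price bounds *)
  psi : 'rV[R]_n;         (* unit costs *)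
  alpha : 'rV[R]_n;
  beta : 'rV[R]_n;
  theta : 'rV[R]_n;       (* first-product distribution *)
  rho : 'M[R]_n;          (* transitions between products *)
  capacity : 'rV[R]_m;    (* varphi_r *)
  usage : 'M[R]_(m, n);   (* phi_rj *)
  volume : R              (* total arrival volume, lambda bar *)
}.

Section Model.
Variables (R : realType) (n m : nat) (d : market R n m).

Definition Qexp (x : 'rV[R]_n) (j : 'I_n) : R :=
  expR (alpha d 0 j - beta d 0 j * x 0 j).

Definition price_bounds (x : 'rV[R]_n) : Prop :=
  forall j, xlo d 0 j <= x 0 j <= xhi d 0 j.

Record standing : Prop := Standing {
  bounds_ordered : forall j, xlo d 0 j <= xhi d 0 j;
  beta_gt0 : forall j, 0 < beta d 0 j;
  Q_range : forall j (t : R), xlo d 0 j <= t <= xhi d 0 j ->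
    0 <= expR (alpha d 0 j - beta d 0 j * t) <= 1;
  theta_ge0 : forall j, 0 <= theta d 0 j;
  theta_sum1 : \sum_j theta d 0 j = 1;
  rho_ge0 : forall i j, 0 <= rho d i j;
  I_rho_nonsingular : 1%:M - rho d \in unitmx;
  rho_series : forall i j,
    (\sum_(1 <= k <oo) ((rho d ^+ k) i j)%:E < +oo)%E;
  volume_ge0 : 0 <= volume d
}.

(* v_j = theta_j + sum_i [1 - a_i exp(alpha_i - beta_i x_i)] rho_ij v_i *)
Definition balance (a x v : 'rV[R]_n) : Prop :=
  forall j, v 0 j =
    theta d 0 j + \sum_i (1 - a 0 i * Qexp x i) * rho d i j * v 0 i.

Definition indic (A : {set 'I_n}) : 'rV[R]_n := \row_i (i \in A)%:R.

Definition CBP2_obj (v : {set 'I_n} -> 'rV[R]_n) (x : 'rV[R]_n)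
    (w : {set 'I_n} -> R) : R :=
  \sum_(A : {set 'I_n}) volume d * w A *
    \sum_(j in A) (x 0 j - psi d 0 j) * Qexp x j * v A 0 j.

Record CBP2_feasible (v : {set 'I_n} -> 'rV[R]_n) (x : 'rV[R]_n)
    (w : {set 'I_n} -> R) : Prop := CBP2Feasible {
  CBP2_capacity : forall r,
    \sum_(A : {set 'I_n}) volume d * w A *
      \sum_(j in A) usage d r j * Qexp x j * v A 0 j <= capacity d 0 r;
  CBP2_w_sum1 : \sum_(A : {set 'I_n}) w A = 1;
  CBP2_w_ge0 : forall A, 0 <= w A;
  CBP2_balance : forall A, balance (indic A) x (v A);
  CBP2_price : price_bounds x
}.

Definition CBP2_optimal v x w : Prop :=
  CBP2_feasible v x w /\
  forall v' x' w', CBP2_feasible v' x' w' ->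
    CBP2_obj v' x' w' <= CBP2_obj v x w.

Definition RP1_obj (v x a : 'rV[R]_n) : R :=
  volume d * \sum_j (x 0 j - psi d 0 j) * a 0 j * Qexp x j * v 0 j.

Record RP1_feasible (v x a : 'rV[R]_n) : Prop := RP1Feasible {
  RP1_balance : balance a x v;
  RP1_capacity : forall r,
    volume d * \sum_j usage d r j * a 0 j * Qexp x j * v 0 j
      <= capacity d 0 r;
  RP1_a_range : forall j, 0 <= a 0 j <= 1;
  RP1_price : price_bounds x
}.

Definition RP1_optimal v x a : Prop :=
  RP1_feasible v x a /\
  forall v' x' a', RP1_feasible v' x' a' ->
    RP1_obj v' x' a' <= RP1_obj v x a.

(* v^A: the unique solution of the balance equations for the assortment A
   (unique under [standing] and [price_bounds x]; the default 0 is not used). *)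
Definition visits (x : 'rV[R]_n) (A : {set 'I_n}) : 'rV[R]_n :=
  xget 0 [set v | balance (indic A) x v].

Section DimensionReduction.
Variables v x a : 'rV[R]_n.

Definition dr_set (s : 'rV[R]_n * 'rV[R]_n) : {set 'I_n} :=
  [set j | 0 < s.2 0 j * s.1 0 j].

(* The division is the one of extended reals: p / 0 = +oo for p > 0. The minimum
   is finite along a run from a feasible input, so [fine] loses nothing. *)
Definition dr_y (s : 'rV[R]_n * 'rV[R]_n) : R :=
  if dr_set s == finset.set0 then 1 else
  fine (\big[mine/+oo%E]_(j in dr_set s)
          ((s.2 0 j * s.1 0 j)%:E / (visits x (dr_set s) 0 j)%:E)%E).

Definition dr_next (s : 'rV[R]_n * 'rV[R]_n) : 'rV[R]_n * 'rV[R]_n :=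
  let A := dr_set s in
  let y := dr_y s in
  let v' := \row_j ((s.1 0 j - y * visits x A 0 j) / (1 - y)) in
  let a' := \row_j
    (if (j \in A) && (v' 0 j != 0)
     then (s.2 0 j * s.1 0 j - y * visits x A 0 j) / ((1 - y) * v' 0 j)
     else 0) in
  (v', a').

(* The pair (hat v, hat a) of iteration k.+1: counting starts at 0 here. The
   values after the stopping iteration are irrelevant. *)
Definition dr_state (k : nat) : 'rV[R]_n * 'rV[R]_n := iter k dr_next (v, a).

Definition dr_A (k : nat) : {set 'I_n} := dr_set (dr_state k).
Definition dr_yk (k : nat) : R := dr_y (dr_state k).

(* The algorithm stops at the end of its K-th iteration. *)
Definition dr_stops_after (K : nat) : Prop :=
  [/\ (0 < K)%N, dr_yk K.-1 = 1 & forall k, (k < K.-1)%N -> dr_yk k <> 1].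

(* w is the weight vector built from the run; v is completed by [visits x]. *)
Definition recovered_weights (w : {set 'I_n} -> R) : Prop :=
  exists K, [/\ dr_stops_after K,
    forall k, (k < K)%N -> w (dr_A k) = (\prod_(l < k) (1 - dr_yk l)) * dr_yk k
    & forall A, (forall k, (k < K)%N -> A <> dr_A k) -> w A = 0].

End DimensionReduction.

Definition aggregate_v (v : {set 'I_n} -> 'rV[R]_n)
    (w : {set 'I_n} -> R) : 'rV[R]_n :=
  \row_j \sum_(A : {set 'I_n}) w A * v A 0 j.

Definition aggregate_a (v : {set 'I_n} -> 'rV[R]_n)
    (w : {set 'I_n} -> R) : 'rV[R]_n :=
  \row_j (if aggregate_v v w 0 j == 0 then 0 else
    (\sum_(A : {set 'I_n}) (j \in A)%:R * w A * v A 0 j)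
      / \sum_(A : {set 'I_n}) w A * v A 0 j).

End Model.

(* Main.v *)
(** Write b_j = a_j v_j. The balance equations are affine in (v, b), and revenue
    and resource use are linear in b, so averaging a solution of (CBP_2) over
    the assortments gives a feasible point of (RP_1) with the same revenue.
    Conversely, each iteration of the algorithm writes the current (v, b) as a
    convex combination of the pure point (v^A, 1_A v^A) and a remainder that is
    again feasible and whose support is strictly smaller. So the algorithm stops,
    and the recovered weights express (v, b) as a mixture of pure points.
    That the ratio y is at most 1, and that the remainder stays feasible, follow
    from a maximum principle: u <= u^+ rho implies u <= 0, because
    p <= p rho with p >= 0 gives N p <= p (rho + ... + rho^N) for all N. *)

Require Import Defs.
From mathcomp Require Import all_boot all_order all_algebra.
From mathcomp Require Import all_classical all_reals all_analysis.
From mathcomp Require Import ring lra.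

Set Implicit Arguments.
Unset Strict Implicit.
Unset Printing Implicit Defensive.
Import Order.TTheory GRing.Theory Num.Theory.
Local Open Scope ring_scope.

(** * Nonnegative matrices with summable powers *)

Lemma subinvariant_pow (R : numDomainType) (n : nat) (M : 'M[R]_n)
    (p : 'I_n -> R) :
  (forall i j, 0 <= M i j) -> (forall j, p j <= \sum_i p i * M i j) ->
  forall k j, p j <= \sum_i p i * (M ^+ k) i j.
Proof.
move=> M0 pM; elim=> [|k IHk] j.
  rewrite (bigD1 j)//= big1 ?addr0 => [|i /negPf ij].
    by rewrite expr0 mxE eqxx mulr1.
  by rewrite expr0 mxE ij mulr0.
apply: (le_trans (pM j)); under [leRHS]eq_bigr do rewrite exprSr mxE mulr_sumr.
rewrite exchange_big/=; apply: ler_sum => l _.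
under eq_bigr do rewrite mulrA.
by rewrite -mulr_suml ler_wpM2r.
Qed.

Lemma summable_subinvariant_eq0 (R : realType) (n : nat) (M : 'M[R]_n)
    (p : 'I_n -> R) :
  (forall i j, 0 <= M i j) ->
  (forall i j, (\sum_(1 <= k <oo) ((M ^+ k) i j)%:E < +oo)%E) ->
  (forall j, 0 <= p j) -> (forall j, p j <= \sum_i p i * M i j) ->
  forall j, p j = 0.
Proof.
move=> M0 Mfin p0 pM j; apply/eqP; rewrite eq_le p0 andbT.
have Mk0 k i l : 0 <= (M ^+ k) i l.
  elim: k i l => [|k IHk] i l; first by rewrite expr0 mxE ler0n.
  by rewrite exprS mxE sumr_ge0// => h _; rewrite mulr_ge0.
pose S i := fine (\sum_(1 <= k <oo) ((M ^+ k) i j)%:E)%E.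
have Sle N i : \sum_(1 <= k < N.+1) (M ^+ k) i j <= S i.
  have le1 : (\sum_(1 <= k < N.+1) ((M ^+ k) i j)%:E <=
              \sum_(1 <= k <oo) ((M ^+ k) i j)%:E)%E.
    by apply: nneseries_lim_ge => k _ _; rewrite lee_fin.
  have fS : (\sum_(1 <= k <oo) ((M ^+ k) i j)%:E)%E \is a fin_num.
    rewrite ge0_fin_numE ?Mfin//; apply: nneseries_ge0 => k _ _.
    by rewrite lee_fin.
  by move: le1; rewrite sumEFin -(fineK fS) lee_fin.
(* [D] bounds entry [j] of p (M + ... + M^N) for every N, so N p_j stays below a constant; the
   Archimedean property then excludes p_j > 0. *)
pose D := \sum_i p i * S i.
have D0 : 0 <= D.
  apply: sumr_ge0 => i _; rewrite mulr_ge0// (le_trans _ (Sle 0%N i))//.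
  by rewrite big_geq.
have ND N : N%:R * p j <= D.
  have -> : N%:R * p j = \sum_(1 <= k < N.+1) p j.
    by rewrite sumr_const_nat subn1 mulr_natl.
  apply: (@le_trans _ _ (\sum_(1 <= k < N.+1) \sum_i p i * (M ^+ k) i j)).
    by apply: ler_sum => k _; exact: subinvariant_pow.
  rewrite exchange_big/=; apply: ler_sum => i _.
  by rewrite -mulr_sumr ler_wpM2l.
rewrite leNgt; apply/negP => pj.
have := ND (Num.bound (D / p j)); apply/negP; rewrite -ltNge.
by rewrite -ltr_pdivrMr// archi_boundP// divr_ge0.
Qed.

(* With the division of extended reals, a zero denominator never realizes the
   minimum, since some quotient is at most 1. *)
Lemma fine_min_ratio (R : realType) (I : finType) (A : {set I})
    (b u : I -> R) :
  (forall j, j \in A -> 0 < b j) -> (forall j, 0 <= u j) ->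
  (exists2 j, j \in A & b j <= u j) ->
  let y := fine (\big[mine/+oo%E]_(j in A) ((b j)%:E / (u j)%:E)%E) in
  [/\ 0 < y, y <= 1, forall j, j \in A -> y * u j <= b j &
      exists2 j, j \in A & b j = y * u j].
Proof.
move=> b0 u0 [k kA bk] /=.
rewrite (bigmin_eq_arg _ k)// => [|i _]; last exact: leey.
case: arg_minP => //= i iA imin.
have divE j : 0 < u j -> ((b j)%:E / (u j)%:E)%E = (b j / u j)%:E.
  by move=> uj; rewrite inver gt_eqF// EFinM.
have uk : 0 < u k by rewrite (lt_le_trans _ bk)// b0.
have ui : 0 < u i.
  rewrite lt_neqAle u0 andbT eq_sym; apply/eqP => ui.
  have := imin _ kA; rewrite (divE k uk) ui inver eqxx.
  by rewrite gt0_muley ?lte_fin ?b0.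
rewrite divE//=; split.
- by rewrite divr_gt0// b0.
- have := imin _ kA; rewrite !divE// lee_fin => /le_trans; apply.
  by rewrite ler_pdivrMr ?mul1r.
- move=> j jA; have := u0 j; rewrite le_eqVlt => /predU1P[<-|uj].
    by rewrite mulr0 ltW// b0.
  by rewrite -ler_pdivlMr// -lee_fin -!divE// imin.
- by exists i => //; rewrite divfK// gt_eqF.
Qed.

(** * Balance equations: maximum principle, existence, uniqueness, comparison *)

Section Network.
Variables (R : realType) (n m : nat) (d : market R n m).
Hypothesis hd : standing d.

(** The right-hand side is nonnegative, so it also bounds the positive part of [u], which is
    therefore subinvariant under [rho] and vanishes. *)
Lemma drift_le0 (u : 'I_n -> R) :
  (forall j, u j <= \sum_i Num.max (u i) 0 * rho d i j) -> forall j, u j <= 0.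
Proof.
move=> uM j; pose p i := Num.max (u i) 0.
suff /(_ j) <- : forall j, p j = 0 by rewrite le_max lexx.
apply: (@summable_subinvariant_eq0 _ _ (rho d)).
- exact: rho_ge0.
- exact: rho_series.
- by move=> i; rewrite le_max lexx orbT.
- move=> i; rewrite ge_max uM/=; apply: sumr_ge0 => l _.
  by rewrite mulr_ge0 ?rho_ge0// le_max lexx orbT.
Qed.

(* [v j] is the volume of visits to product [j] and [b j = a j * v j] the part
   of it that is offered; the system is jointly affine in [(v, b)]. *)
Definition flow (x : 'rV[R]_n) (v b : 'I_n -> R) : Prop :=
  forall j, v j =
    theta d 0 j + \sum_i (v i - Qexp d x i * b i) * rho d i j.

Record subflow (x : 'rV[R]_n) (v b : 'I_n -> R) : Prop := Subflow {
  subflow_flow : flow x v b;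
  subflow_bounds : forall j, 0 <= b j <= v j
}.

Lemma balance_flow (a x v : 'rV[R]_n) :
  balance d a x v <-> flow x (v 0) (fun j => a 0 j * v 0 j).
Proof.
by split=> H j; rewrite H; congr (_ + _); apply: eq_bigr => i _; ring.
Qed.

Definition offered (A : {set 'I_n}) (v : 'rV[R]_n) (j : 'I_n) : R :=
  (j \in A)%:R * v 0 j.

Lemma balance_indicE (A : {set 'I_n}) (x v : 'rV[R]_n) :
  balance d (Defs.indic R A) x v <-> flow x (v 0) (offered A v).
Proof.
split=> [/balance_flow H j|H]; last apply/balance_flow => j; rewrite H;
  by congr (_ + _); apply: eq_bigr => i _; rewrite /offered mxE.
Qed.

Variable x : 'rV[R]_n.
Hypothesis hx : price_bounds d x.

Lemma Q01 j : 0 <= Qexp d x j <= 1.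
Proof. exact: (Q_range hd (hx j)). Qed.

Lemma balance_ge0 (a v : 'rV[R]_n) : (forall j, 0 <= a 0 j <= 1) ->
  balance d a x v -> forall j, 0 <= v 0 j.
Proof.
move=> a01 va j; rewrite -oppr_le0.
apply: (@drift_le0 (fun j => - v 0 j)) => {}j; rewrite va opprD.
rewrite -[leRHS]add0r lerD ?oppr_le0 ?theta_ge0// -sumrN ler_sum// => i _.
have /andP[a0 a1] := a01 i; have /andP[q0 q1] := Q01 i.
rewrite mulrAC -mulNr ler_wpM2r ?rho_ge0// -mulrN.
have c0 : 0 <= 1 - a 0 i * Qexp d x i <= 1 by apply/andP; split; nra.
rewrite le_max; case: (lerP 0 (v 0 i)) => v0; apply/orP; [right|left]; nra.
Qed.

Lemma balance_unique (a u v : 'rV[R]_n) : (forall j, 0 <= a 0 j <= 1) ->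
  balance d a x u -> balance d a x v -> u = v.
Proof.
move=> a01; wlog suff le : u v / balance d a x u -> balance d a x v ->
    forall j, u 0 j - v 0 j <= 0.
  move=> ua va; apply/rowP => j; apply/eqP; rewrite eq_le.
  by rewrite -subr_le0 le// -subr_le0 le.
move=> ua va; apply: (@drift_le0 (fun j => u 0 j - v 0 j)) => j.
rewrite ua va opprD addrACA subrr add0r -sumrB ler_sum// => i _.
have /andP[a0 a1] := a01 i; have /andP[q0 q1] := Q01 i.
have c0 : 0 <= 1 - a 0 i * Qexp d x i <= 1 by apply/andP; split; nra.
rewrite mulrAC [X in _ - X]mulrAC -mulrBl ler_wpM2r ?rho_ge0// -mulrBr le_max.
case: (lerP (u 0 i - v 0 i) 0) => v0; apply/orP; [right|left]; nra.
Qed.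

Lemma indic01 (A : {set 'I_n}) j : 0 <= Defs.indic R A 0 j <= 1.
Proof. by rewrite mxE; case: (j \in A); rewrite /= ?lexx ?ler01. Qed.

(** In finite dimension injectivity suffices: a row vector killed by [1%:M - B] solves the balance
    equations with zero source, and [drift_le0] applied to it and to its opposite ([s] = 1 and [s] =
    -1) makes it vanish. *)
Lemma balance_exists (a : 'rV[R]_n) : (forall j, 0 <= a 0 j <= 1) ->
  exists v, balance d a x v.
Proof.
move=> a01; pose B := \matrix_(i, j) ((1 - a 0 i * Qexp d x i) * rho d i j).
have balE (t v : 'rV[R]_n) : v *m (1%:M - B) = t ->
    forall j, v 0 j =
      t 0 j + \sum_i (1 - a 0 i * Qexp d x i) * rho d i j * v 0 i.
  move=> <- j; rewrite mulmxBr mulmx1 !mxE.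
  under [X in _ - X]eq_bigr do rewrite mxE mulrC.
  by rewrite subrK.
have : row_free (1%:M - B).
  apply: inj_row_free => v /balE v0.
  have half (s : R) : s * s = 1 -> forall j, s * v 0 j <= 0.
    move=> s1; apply: (@drift_le0 (fun j => s * v 0 j)) => j.
    rewrite v0 mxE add0r mulr_sumr ler_sum// => i _.
    have /andP[a0 a1] := a01 i; have /andP[q0 q1] := Q01 i.
    have c0 : 0 <= 1 - a 0 i * Qexp d x i <= 1 by apply/andP; split; nra.
    rewrite mulrAC mulrA ler_wpM2r ?rho_ge0// mulrCA le_max.
    case: (lerP (s * v 0 i) 0) => vi; apply/orP; [right|left]; nra.
  apply/rowP => j; rewrite mxE; apply/eqP; rewrite eq_le.
  rewrite -[X in X <= 0]mul1r half ?mulr1//=.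
  by rewrite -oppr_le0 -mulN1r half ?mulrNN ?mulr1.
rewrite row_free_unit => Bu; exists (theta d *m invmx (1%:M - B)).
by apply: balE; rewrite mulmxKV.
Qed.

Lemma visits_balance A : balance d (Defs.indic R A) x (visits d x A).
Proof. exact: (xgetPex 0 (balance_exists (indic01 A))). Qed.

Lemma balance_visits A v : balance d (Defs.indic R A) x v -> v = visits d x A.
Proof.
by move=> vA; apply: (balance_unique (indic01 A)) => //; exact: visits_balance.
Qed.

Lemma visits_ge0 A j : 0 <= visits d x A 0 j.
Proof. exact: (balance_ge0 (indic01 A) (visits_balance A)). Qed.

Lemma visits_flow A : flow x (visits d x A 0) (offered A (visits d x A)).
Proof. exact/balance_indicE/visits_balance. Qed.

(** Solutions of an affine system are closed under affine combinations, here the remainder left when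
    a share [y] of (u, o) is removed from (v, b). *)
Lemma flow_extrapolate (y : R) (v b u o v' b' : 'I_n -> R) :
  y != 1 -> flow x v b -> flow x u o ->
  (forall j, (1 - y) * v' j = v j - y * u j) ->
  (forall j, (1 - y) * b' j = b j - y * o j) -> flow x v' b'.
Proof.
move=> y1 vb uo v'E b'E j; apply: (@mulfI _ (1 - y)).
  by rewrite subr_eq0 eq_sym.
rewrite v'E vb uo [RHS]mulrDr [X in _ = _ + X]mulr_sumr.
under [X in _ = _ + X]eq_bigr => i _.
  rewrite mulrA mulrBr v'E mulrCA b'E.
  rewrite (_ : _ * rho d i j = (v i - Qexp d x i * b i) * rho d i j
    - y * ((u i - Qexp d x i * o i) * rho d i j)); last by ring.
  over.
by rewrite sumrB -mulr_sumr; ring.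
Qed.

(** In the difference of the two flows [theta] cancels. On [A] the larger offered volume [b] only
    lowers what is passed on, and off [A] nothing is offered in either flow, so [drift_le0]
    applies. *)
Lemma visits_dominates (v b : 'I_n -> R) (A : {set 'I_n}) : subflow x v b ->
  (forall j, j \notin A -> b j = 0) ->
  (forall j, j \in A -> visits d x A 0 j <= b j) ->
  forall j, v j <= visits d x A 0 j.
Proof.
move=> [vb _] bA0 bA j; rewrite -subr_le0.
apply: (@drift_le0 (fun j => v j - visits d x A 0 j)) => {}j.
rewrite vb (visits_flow A) opprD addrACA subrr add0r -sumrB ler_sum// => i _.
rewrite -mulrBl ler_wpM2r ?rho_ge0// le_max /offered.
have /andP[q0 _] := Q01 i; apply/orP; left.
have [iA|/bA0 ->] := boolP (i \in A); last by rewrite mulr0n mul0r mulr0 !subr0.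
by have := bA i iA; rewrite mulr1n mul1r; nra.
Qed.

(** On [A] the chain v^A <= b <= v <= v^A collapses. Hence [v] solves the balance equations of [A],
    and uniqueness gives equality off [A] as well. *)
Lemma saturated_eq (v : 'rV[R]_n) (b : 'I_n -> R) (A : {set 'I_n}) :
  subflow x (v 0) b -> (forall j, j \notin A -> b j = 0) ->
  (forall j, j \in A -> visits d x A 0 j <= b j) ->
  v = visits d x A /\ b =1 offered A (visits d x A).
Proof.
move=> vb bA0 bA; have vle := visits_dominates vb bA0 bA.
have bE : b =1 offered A (visits d x A).
  move=> j; rewrite /offered.
  have [jA|/bA0 ->] := boolP (j \in A); last by rewrite mulr0n mul0r.
  rewrite mulr1n mul1r; apply/eqP; rewrite eq_le bA// andbT.
  by case: vb => _ /(_ j)/andP[_ /le_trans]; apply; exact: vle.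
have bE' : b =1 offered A v.
  move=> j; rewrite /offered.
  have [jA|/bA0 ->] := boolP (j \in A); last by rewrite mulr0n mul0r.
  rewrite mulr1n mul1r; apply/eqP; rewrite eq_le.
  case: vb => _ /(_ j)/andP[_ -> /=].
  exact: le_trans (vle j) (bA j jA).
split=> //; apply: balance_visits; apply/balance_indicE => j.
case: vb => -> _; congr (_ + _); apply: eq_bigr => i _.
by rewrite bE'.
Qed.

(** * One iteration of the algorithm *)

Definition served (s : 'rV[R]_n * 'rV[R]_n) (j : 'I_n) : R :=
  s.2 0 j * s.1 0 j.

Definition dr_invariant (s : 'rV[R]_n * 'rV[R]_n) : Prop :=
  subflow x (s.1 0) (served s).

Section Step.
Variable s : 'rV[R]_n * 'rV[R]_n.
Hypothesis hs : dr_invariant s.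
Let A := dr_set s.
Let y := dr_y d x s.
Let u := visits d x A.

Lemma served_notin j : j \notin A -> served s j = 0.
Proof.
rewrite inE -leNgt => sj; apply/eqP; rewrite eq_le sj /=.
by case: hs => _ /(_ j)/andP[].
Qed.

Lemma dr_y_spec :
  [/\ 0 < y, y <= 1, forall j, j \in A -> y * u 0 j <= served s j &
      A != finset.set0 -> exists2 j, j \in A & served s j = y * u 0 j].
Proof.
rewrite /y /dr_y -/A; case: eqVneq => [A0|An0].
  by split=> // j; rewrite A0 inE.
have [|||? ? ? ?] := @fine_min_ratio R _ A (served s) (u 0).
- by move=> j; rewrite inE.
- exact: visits_ge0.
(* If every ratio exceeded 1, domination would give v <= v^A < b <= v at any product of [A]. *)
- apply: contrapT => none.
  have lt_served j : j \in A -> u 0 j < served s j.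
    by move=> jA; rewrite ltNge; apply/negP => le; apply: none; exists j.
  have /set0Pn[j jA] := An0.
  have := visits_dominates hs served_notin (fun i iA => ltW (lt_served i iA)) j.
  apply/negP; rewrite -ltNge (lt_le_trans (lt_served j jA))//.
  by case: hs => _ /(_ j)/andP[].
- by split.
Qed.

(** The stopping state is itself a pure point, so stopping leaves no remainder. This includes the
    stop at an empty [A]. *)
Lemma dr_y_eq1 : y = 1 -> s.1 = u /\ served s =1 offered A u.
Proof.
move=> y1; apply: saturated_eq => // [|j jA]; first exact: served_notin.
by case: dr_y_spec => _ _ /(_ j jA); rewrite y1 mul1r.
Qed.

Hypothesis y_neq1 : y != 1.

Let s' := dr_next d x s.
(** The remainder of the offered volume, free of the division by the new visits; [servedE]
    identifies it with the product of the new a and v. *)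
Let c j := (served s j - y * offered A u j) / (1 - y).

Let y_lt1 : 0 < 1 - y.
Proof.
by case: dr_y_spec => _ y1 _ _; rewrite subr_gt0 lt_neqAle y_neq1.
Qed.

Let y1_neq0 : 1 - y != 0. Proof. by rewrite gt_eqF. Qed.

Lemma dr_next_visits j : (1 - y) * s'.1 0 j = s.1 0 j - y * u 0 j.
Proof. by rewrite mxE mulrC divfK. Qed.

Let next_served j : (1 - y) * c j = served s j - y * offered A u j.
Proof. by rewrite mulrC divfK. Qed.

Let next_served_notin j : j \notin A -> c j = 0.
Proof.
by move=> jA; rewrite /c served_notin// /offered (negPf jA) mul0r mulr0 subr0 mul0r.
Qed.

Let next_served_ge0 j : 0 <= c j.
Proof.
have [jA|/next_served_notin ->//] := boolP (j \in A).
rewrite divr_ge0 ?(ltW y_lt1)// subr_ge0 /offered jA mul1r.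
by case: dr_y_spec => _ _ /(_ j jA).
Qed.

(** On [A] the same y v^A is subtracted from b and from v, so their order is kept. *)
Let next_served_le j : j \in A -> c j <= s'.1 0 j.
Proof.
move=> jA; rewrite -(ler_pM2l y_lt1) next_served dr_next_visits.
by rewrite /offered jA mul1r lerB// ; case: hs => _ /(_ j)/andP[].
Qed.

Let next_flow : flow x (s'.1 0) c.
Proof.
apply: (@flow_extrapolate y) dr_next_visits next_served => //.
  exact: subflow_flow hs.
exact: visits_flow.
Qed.

(** Off [A] the subtraction might go below zero, hence the maximum principle for -v': a product of
    [A] passes on v' - Q c >= 0, any other passes on all of v'. *)
Let next_visits_ge0 j : 0 <= s'.1 0 j.
Proof.
rewrite -oppr_le0; apply: (@drift_le0 (fun j => - s'.1 0 j)) => {}j.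
rewrite next_flow opprD -[leRHS]add0r lerD ?oppr_le0 ?theta_ge0//.
rewrite -sumrN ler_sum// => i _; rewrite -mulNr ler_wpM2r ?rho_ge0// le_max.
have /andP[q0 q1] := Q01 i; apply/orP.
have [iA|/next_served_notin ->] := boolP (i \in A).
  right; have := next_served_le iA; have := next_served_ge0 i; nra.
by left; rewrite mulr0 subr0.
Qed.

Let servedE j : served s' j = c j.
Proof.
rewrite /served [s'.2 0 j]mxE; have [jA|jA] := boolP (j \in A); last first.
  by rewrite mul0r next_served_notin.
(* When v'_j = 0 the default a'_j = 0 is consistent, since 0 <= c_j <= v'_j. *)
rewrite -/(s'.1); have [z0|z0] := eqVneq (s'.1 0 j) 0.
  rewrite /= mul0r; apply/eqP; rewrite eq_le next_served_ge0/=.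
  by rewrite -z0 next_served_le.
rewrite /= -/y -/u /c /offered jA mul1r /served.
by field; rewrite y1_neq0 z0.
Qed.

Lemma dr_next_served j :
  (1 - y) * served s' j = served s j - y * offered A u j.
Proof. by rewrite servedE next_served. Qed.

Lemma dr_next_invariant : dr_invariant s'.
Proof.
split=> [j|j]; rewrite ?servedE.
  rewrite next_flow; congr (_ + _); apply: eq_bigr => i _.
  by rewrite servedE.
rewrite next_served_ge0/=; have [/next_served_le//|jA] := boolP (j \in A).
by rewrite next_served_notin.
Qed.

(** Products outside [A] stay out, and one attaining the minimal ratio leaves because its remainder
    is zero. *)
Lemma dr_next_proper : dr_set s' \proper A.
Proof.
have An0 : A != finset.set0.
  by apply: contra_neq y_neq1 => A0; rewrite /y /dr_y -/A A0 eqxx.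
apply/properP; split.
  apply/fintype.subsetP => j; rewrite inE -/(served s' j) servedE.
  by apply: contraTT => /next_served_notin ->; rewrite ltxx.
case: dr_y_spec => _ _ _ /(_ An0)[j jA jE]; exists j => //.
by rewrite inE -/(served s' j) servedE /c jE /offered jA mul1r subrr mul0r ltxx.
Qed.

End Step.

(** * Runs of the algorithm and recovered weights *)

Section Run.
Variables v a : 'rV[R]_n.
Hypothesis hva : dr_invariant (v, a).
Let state k := dr_state d v x a k.
Let A k := dr_A d v x a k.
Let y k := dr_yk d v x a k.

Lemma dr_state_invariant k :
  (forall l, (l < k)%N -> y l <> 1) -> dr_invariant (state k).
Proof.
elim: k => [//|k IHk] y1; rewrite /state /dr_state iterS.
apply: dr_next_invariant; first by apply: IHk => l /ltnW; exact: y1.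
exact/eqP/y1.
Qed.

(** Each step loses at least one product. The start [l] is arbitrary so that the bound yields both
    termination ([l] = 0) and distinctness of the sets. *)
Lemma dr_A_card l k : (forall i, (i < l + k)%N -> y i <> 1) ->
  (#|A (l + k)| + k <= #|A l|)%N.
Proof.
elim: k => [|k IHk] y1; first by rewrite !addn0.
have y1' i : (i < l + k)%N -> y i <> 1.
  by move=> ik; apply: y1; rewrite addnS ltnW.
apply: leq_trans (IHk y1'); rewrite !addnS -addSn leq_add2r.
apply: proper_card; rewrite /A /dr_A /dr_state iterS; apply: dr_next_proper.
  exact: dr_state_invariant.
by apply/eqP/y1; rewrite addnS.
Qed.

Lemma dr_stops : exists K, dr_stops_after d v x a K.
Proof.
have ex1 : exists k, y k == 1.
  apply: contrapT => none.
  (* Without a stop, n + 1 steps would remove n + 1 of only n products. *)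
  have := @dr_A_card 0 n.+1 (fun i _ yi => none (ex_intro _ i (introT eqP yi))).
  apply/negP; rewrite -ltnNge addnS ltnS (leq_trans (max_card _))//.
  by rewrite card_ord leq_addl.
case: (ex_minnP ex1) => k /eqP yk kmin; exists k.+1; split=> //= l lk /eqP /kmin.
by rewrite leqNgt lk.
Qed.

Variable K : nat.
Hypothesis hK : dr_stops_after d v x a K.

Lemma dr_before_stop k : (k < K)%N -> forall l, (l < k)%N -> y l <> 1.
Proof.
move=> kK l lk; case: hK => K0 _; apply.
by apply: leq_trans lk _; rewrite -ltnS prednK.
Qed.

Lemma dr_running_invariant k : (k < K)%N -> dr_invariant (state k).
Proof. by move=> kK; apply/dr_state_invariant/dr_before_stop. Qed.

(** Distinctness makes the recovery construction consistent: no assortment is assigned two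
    weights. *)
Lemma dr_A_inj : {in gtn K &, injective A}.
Proof.
suff lt_neq k l : (k < l < K)%N -> A k <> A l.
  move=> k l kK lK; case: (ltngtP k l) => // [kl|lk] Akl.
    by case: (@lt_neq k l) => //; rewrite kl.
  by case: (@lt_neq l k) => //; rewrite lk.
case/andP=> kl lK Akl; have := @dr_A_card k (l - k).
rewrite subnKC ?(ltnW kl)// => /(_ (dr_before_stop lK)).
by rewrite -Akl -[leqRHS]addn0 leq_add2l leqn0 subn_eq0 leqNgt kl.
Qed.

Definition dr_weight k : R :=
  (\prod_(l < k) (1 - dr_yk d v x a l)) * dr_yk d v x a k.

Lemma dr_weight_ge0 k : (k < K)%N -> 0 <= dr_weight k.
Proof.
move=> kK; have y01 l : (l <= k)%N -> 0 < y l <= 1.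
  move=> lk; have := dr_running_invariant (leq_ltn_trans lk kK).
  by case/dr_y_spec=> *; apply/andP.
rewrite mulr_ge0//; last by case/andP: (y01 k (leqnn k)) => /ltW.
apply: prodr_ge0 => l _; rewrite subr_ge0.
by case/andP: (y01 l (ltnW (ltn_ord l))).
Qed.

(* [g] is a quantity carried by the state and [F] its value on a pure
   assortment; the residual product vanishes since the last step has [y = 1]. *)
Lemma dr_telescope (g : 'rV[R]_n * 'rV[R]_n -> R) (F : {set 'I_n} -> R) :
  (forall s, dr_invariant s -> dr_y d x s = 1 -> g s = F (dr_set s)) ->
  (forall s, dr_invariant s -> dr_y d x s != 1 ->
     (1 - dr_y d x s) * g (dr_next d x s) =
     g s - dr_y d x s * F (dr_set s)) ->
  g (v, a) = \sum_(k < K) dr_weight k * F (A k).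
Proof.
move=> g1 gnext.
have partial k : (k <= K)%N -> g (v, a) =
    \sum_(l < k) dr_weight l * F (A l) + \prod_(l < k) (1 - y l) * g (state k).
  elim: k => [|k IHk] kK; first by rewrite !big_ord0 add0r mul1r.
  rewrite (IHk (ltnW kK)) !big_ord_recr/= -addrA; congr (_ + _).
  have inv := dr_running_invariant kK.
  have step : (1 - y k) * g (state k.+1) = g (state k) - y k * F (A k).
    (* If y = 1 the next state comes from divisions by zero, but its factor 1 - y is 0, and [g1]
       makes the right-hand side 0 too. *)
    have [y1|y1] := eqVneq (y k) 1.
      by rewrite y1 subrr mul0r mul1r (g1 _ inv y1) subrr.
    exact: gnext.
  by rewrite -mulrA step mulrBr mulrA addrC subrK.
rewrite (partial K)//; have [K0 yK _] := hK.
rewrite -[in X in _ + X](prednK K0) big_ord_recr/= /y yK subrr mulr0 mul0r addr0.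
by [].
Qed.

End Run.

Lemma recovered_weights_exist (v a : 'rV[R]_n) : dr_invariant (v, a) ->
  exists w, recovered_weights d v x a w.
Proof.
move=> hva; have [K hK] := dr_stops hva.
(* By [dr_A_inj] this sum has at most one term; it is empty, hence 0, on assortments outside the
   run. *)
exists (fun B => \sum_(k < K | dr_A d v x a k == B) dr_weight v a k), K.
split=> // [k kK|B hB].
  rewrite (big_pred1 (Ordinal kK))// => l /=.
  apply/eqP/eqP => [/(dr_A_inj hva hK) kl|->//].
  by apply/val_inj/kl; rewrite inE.
by rewrite big_pred0// => k; apply/eqP => kB; apply: (hB k).
Qed.

Section Recovered.
Variables (v a : 'rV[R]_n) (w : {set 'I_n} -> R).
Hypothesis hva : dr_invariant (v, a).
Hypothesis hw : recovered_weights d v x a w.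

Lemma recovered_ge0 B : 0 <= w B.
Proof.
have [K [hK wA w0]] := hw.
have [[k kK ->]|none] := pselect (exists2 k, (k < K)%N & B = dr_A d v x a k).
  by have := dr_weight_ge0 hva hK kK; rewrite wA.
by rewrite w0// => k kK kB; apply: none; exists k.
Qed.

(** Reindexes [dr_telescope] from iterations to assortments. It is used with g = 1 for the total
    weight and g = [served] for the offered volumes. *)
Lemma recovered_combination (g : 'rV[R]_n * 'rV[R]_n -> R)
    (F : {set 'I_n} -> R) :
  (forall s, dr_invariant s -> dr_y d x s = 1 -> g s = F (dr_set s)) ->
  (forall s, dr_invariant s -> dr_y d x s != 1 ->
     (1 - dr_y d x s) * g (dr_next d x s) =
     g s - dr_y d x s * F (dr_set s)) ->
  g (v, a) = \sum_B w B * F B.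
Proof.
move=> g1 gnext; have [K [hK wA w0]] := hw.
rewrite (dr_telescope hva hK g1 gnext).
rewrite (bigID (mem [set dr_A d v x a (k : 'I_K) | k in 'I_K]))/=.
rewrite [X in _ + X]big1 ?addr0 => [|B nB].
  rewrite big_imset/= => [|k l _ _ /(dr_A_inj hva hK) kl].
    by apply: eq_bigr => k _; rewrite wA.
  by apply/val_inj/kl; rewrite inE/=.
rewrite w0 ?mul0r// => k kK BA; case/negP: nB.
by apply/imsetP; exists (Ordinal kK).
Qed.

Lemma recovered_sum1 : \sum_B w B = 1.
Proof.
transitivity (\sum_B w B * 1); first by under [RHS]eq_bigr do rewrite mulr1.
by rewrite -(@recovered_combination (fun=> 1))// => s _ _; rewrite !mulr1.
Qed.

Lemma recovered_served j :
  a 0 j * v 0 j = \sum_B w B * offered B (visits d x B) j.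
Proof.
apply: (@recovered_combination (fun s => served s j)) => s hs y1.
  by have [_ ->] := dr_y_eq1 hs y1.
exact: dr_next_served.
Qed.

End Recovered.

(** * Transfer of feasibility and revenue between the two problems *)

Lemma RP1_invariant (v a : 'rV[R]_n) :
  RP1_feasible d v x a -> dr_invariant (v, a).
Proof.
case=> va _ a01 _; split=> [|j]; first exact/balance_flow.
rewrite /served/=; have /andP[a0 a1] := a01 j.
by have v0 := balance_ge0 a01 va j; rewrite mulr_ge0//= ler_piMl.
Qed.

(** Serves revenue and capacities in both directions: [c] is the unit margin or a row of [usage],
    and only the products a_j v_j matter. *)
Lemma mixture_consumption (c : 'I_n -> R) (v a : 'rV[R]_n)
    (V : {set 'I_n} -> 'rV[R]_n) (w : {set 'I_n} -> R) :
  (forall j, a 0 j * v 0 j = \sum_B w B * offered B (V B) j) ->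
  volume d * (\sum_j c j * a 0 j * Qexp d x j * v 0 j) =
  \sum_B volume d * w B * \sum_(j in B) c j * Qexp d x j * V B 0 j.
Proof.
move=> avE.
under eq_bigr => j _.
  rewrite (_ : _ * v 0 j = c j * Qexp d x j * (a 0 j * v 0 j)); last by ring.
  rewrite avE mulr_sumr; over.
rewrite exchange_big/= mulr_sumr; apply: eq_bigr => B _.
rewrite -mulrA; congr (_ * _); rewrite mulr_sumr [RHS]big_mkcond/=.
apply: eq_bigr => j _; rewrite /offered.
by case: (j \in B); rewrite ?mulr1n ?mulr0n; ring.
Qed.

Lemma recovered_feasible (v a : 'rV[R]_n) (w : {set 'I_n} -> R) :
  RP1_feasible d v x a -> recovered_weights d v x a w ->
  CBP2_feasible d (visits d x) x w /\
  CBP2_obj d (visits d x) x w = RP1_obj d v x a.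
Proof.
move=> hva hw; have inv := RP1_invariant hva.
have avE := recovered_served inv hw.
split; last by rewrite /RP1_obj (mixture_consumption _ avE).
split=> //.
- by move=> r; rewrite -(mixture_consumption _ avE); case: hva => _ /(_ r).
- exact: recovered_sum1 inv hw.
- exact: recovered_ge0 inv hw.
- exact: visits_balance.
Qed.

Lemma aggregate_feasible (v : {set 'I_n} -> 'rV[R]_n) (w : {set 'I_n} -> R) :
  CBP2_feasible d v x w ->
  RP1_feasible d (aggregate_v v w) x (aggregate_a v w) /\
  RP1_obj d (aggregate_v v w) x (aggregate_a v w) = CBP2_obj d v x w.
Proof.
case=> cap w1 w0 bal _.
have v0 B j : 0 <= v B 0 j := balance_ge0 (indic01 B) (bal B) j.
pose b j := \sum_B w B * offered B (v B) j.
have vE j : aggregate_v v w 0 j = \sum_B w B * v B 0 j by rewrite mxE.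
have bE (j : 'I_n) : \sum_(B : {set 'I_n}) (j \in B)%:R * w B * v B 0 j = b j.
  by apply: eq_bigr => B _; rewrite mulrAC mulrC.
have b0 j : 0 <= b j.
  by apply: sumr_ge0 => B _; rewrite !mulr_ge0.
have bv j : b j <= aggregate_v v w 0 j.
  rewrite vE ler_sum// => B _; rewrite ler_wpM2l// ler_piMl//.
  by case: (j \in B); rewrite ?ler01.
have aE j : aggregate_a v w 0 j =
    if aggregate_v v w 0 j == 0 then 0 else b j / aggregate_v v w 0 j.
  by rewrite mxE bE -vE.
(* The default 0 is harmless: where the aggregate visits vanish, so does [b], by 0 <= b <= v. *)
have avE j : aggregate_a v w 0 j * aggregate_v v w 0 j = b j.
  rewrite aE; case: eqVneq => [vj0|vj]; last by rewrite divfK.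
  by rewrite mul0r; apply/eqP; rewrite eq_le b0/= -vj0 bv.
split; last by rewrite /RP1_obj (mixture_consumption _ avE).
split=> //.
- apply/balance_flow => j; rewrite vE.
  under eq_bigr => B _.
    have /balance_indicE -> := bal B.
    rewrite mulrDr mulr_sumr; over.
  rewrite big_split/= -mulr_suml w1 mul1r; congr (_ + _).
  rewrite exchange_big/=; apply: eq_bigr => i _.
  rewrite avE vE /b mulr_sumr -sumrB mulr_suml; apply: eq_bigr => B _.
  by ring.
- by move=> r; rewrite (mixture_consumption _ avE).
- move=> j; rewrite aE; case: eqVneq => [_|vj]; first by rewrite lexx ler01.
  have vgt0 : 0 < aggregate_v v w 0 j by rewrite lt_neqAle eq_sym vj (le_trans _ (bv j)).
  by rewrite divr_ge0 ?(ltW vgt0)//= ler_pdivrMr// mul1r.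
Qed.

End Network.

Theorem theorem5p3 (R : realType) (n m : nat) (d : market R n m)
  (hd : standing d) :
  (forall v x a : 'rV[R]_n, RP1_optimal d v x a ->
     (exists w, recovered_weights d v x a w) /\
     (forall w, recovered_weights d v x a w ->
        CBP2_optimal d (visits d x) x w)) /\
  (forall (v : {set 'I_n} -> 'rV[R]_n) (x : 'rV[R]_n) (w : {set 'I_n} -> R),
     CBP2_optimal d v x w ->
     RP1_optimal d (aggregate_v v w) x (aggregate_a v w)).
Proof.
split=> [v x a [hva opt]|v x w [hvw opt]].
  have hx := RP1_price hva; split=> [|w hw].
    exact: (recovered_weights_exist hd hx (RP1_invariant hd hx hva)).
  have [feas objE] := recovered_feasible hd hx hva hw.
  split=> // v' x' w' hvw'; rewrite objE.
  (* A competitor is carried to the other problem at equal revenue, where optimality is known; the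
     converse part does the same through recovery. *)
  have [feas' <-] := aggregate_feasible hd (CBP2_price hvw') hvw'.
  exact: opt.
have [feas objE] := aggregate_feasible hd (CBP2_price hvw) hvw.
split=> // v' x' a' hva'; rewrite objE; have hx' := RP1_price hva'.
have [w' hw'] := recovered_weights_exist hd hx' (RP1_invariant hd hx' hva').
have [feas' <-] := recovered_feasible hd hx' hva' hw'.
exact: opt.
Qed.
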